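(* Let $PG_n$ be the undirected, unweighted path-graph on $[n]=\{1,\dots,n\}$ and let $x,y\in[n]$ with $d:=y-x>0$. Then for every $q>0$, $$U_q^{(PG_n)}(x,y)=1-\frac{Z_{PG_{n-d}}(q)}{Z_{PG_n}(q)}-\frac{d\left[Z_{PG_x}(q)-Z_{PG_{x-1}}(q)\right]\left[Z_{PG_{n-y+1}}(q)-Z_{PG_{n-y}}(q)\right]}{q\,Z_{PG_n}(q)}.$$ Moreover, with $S=(S_m)_{m\in\mathbb{N}_0}$ the discrete-time simple random walk on $\mathbb{Z}$ started at $0$, $$\left(1-\left(\tfrac{2}{2+q}\right)^{m}\right)^2\left(2\mathbb{P}(|S_m|<\tfrac d2)-1\right)^2\le U_q^{(PG_n)}(x,y)\le1-\mathbb{P}(|S_m|>d)\left(\tfrac{2}{2+q}\right)^{m},$$ where the upper bound holds for every $m\in\mathbb{N}$, and the lower bound holds for every $m\in\mathbb{N}$ such that $\mathbb{P}(|S_m|<\tfrac d2)\ge\tfrac12$.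
   Context: $PG_n$ has edges between $i$ and $i+1$ for $1\le i\le n-1$, each considered as two directed edges of weight $1$. A rooted spanning forest of a finite directed graph is a subset $F$ of its directed edges such that each vertex has at most one outgoing edge in $F$ and $F$ contains no directed cycle; its roots are the vertices without outgoing edge in $F$ and $r(F)$ is the number of roots. For a graph $G$ with all edge weights $1$, $Z_G(q)=\sum_F q^{r(F)}$ (sum over rooted spanning forests of $G$), and for $q>0$ the random rooted spanning forest $\Phi_q$ of $G$ has law $\mathbb{P}(\Phi_q=F)=q^{r(F)}/Z_G(q)$. $U_q^{(G)}(x,y)$ is the probability that $x$ and $y$ belong to different trees (connected components, ignoring orientation) of $\Phi_q$. Convention: $Z_{PG_0}(q):=0$. *)

(* Defs.v *)
From HB Require Import structures.
From mathcomp Require Import all_boot all_order all_algebra.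
From mathcomp Require Import reals.
Set Implicit Arguments.
Unset Strict Implicit.
Unset Printing Implicit Defensive.
Import Order.TTheory GRing.Theory Num.Theory.
Local Open Scope ring_scope.

Section RootedForests.
Variable T : finType.

(* The directed edge u -> v is the pair (u, v); an undirected edge of a graph
   is present in [e : rel T] in both directions, and all weights are 1. *)
Implicit Types (e : rel T) (F : {set T * T}).

Definition arc F : rel T := [rel u v | (u, v) \in F].

Definition out_edges F (u : T) : {set T * T} := [set a in F | a.1 == u].

(* See [acyclicP] for the formulation with closed directed walks. *)
Definition acyclic F : bool :=
  [forall u, forall v, arc F u v ==> ~~ connect (arc F) v u].

Lemma acyclicP F :
  reflect (forall s : seq T, s != [::] -> ~~ cycle (arc F) s) (acyclic F).
Proof.
apply: (iffP idP) => [acF [//|u p] _ | noC].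
  apply/negP; case: p => [|v p] /=.
    rewrite andbT => uu; move/forallP/(_ u)/forallP/(_ u)/implyP/(_ uu): acF.
    by rewrite connect0.
  case/andP=> uv vp; move/forallP/(_ u)/forallP/(_ v)/implyP/(_ uv): acF.
  by case/connectP; exists (rcons p u); rewrite ?last_rcons.
apply/forallP=> u; apply/forallP=> v; apply/implyP=> uv.
apply/negP=> /connectP[p vp def_u].
have /negP[] := noC (v :: p) isT.
by rewrite /= rcons_path vp -def_u.
Qed.

Definition rooted_spanning_forest e F : bool :=
  [&& F \subset [set a | e a.1 a.2],
      [forall u, #|out_edges F u| <= 1]%N
    & acyclic F].

Definition roots F : {set T} := [set u | out_edges F u == set0].

Definition same_tree F (x y : T) : bool :=
  connect [rel u v | arc F u v || arc F v u] x y.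

Section Law.
Variable R : realType.
Implicit Type q : R.

Definition forest_Z e q : R :=
  \sum_(F : {set T * T} | rooted_spanning_forest e F) q ^+ #|roots F|.

Definition forest_law e q F : R := q ^+ #|roots F| / forest_Z e q.

Definition forest_prob e q (A : pred {set T * T}) : R :=
  \sum_(F : {set T * T} | rooted_spanning_forest e F && A F) forest_law e q F.

Definition separation_prob e q (x y : T) : R :=
  forest_prob e q (fun F => ~~ same_tree F x y).

End Law.
End RootedForests.

(* The vertex k of {1, ..., n} is represented by the ordinal k - 1 of 'I_n. *)
Definition path_graph (n : nat) : rel 'I_n :=
  fun i j => (i.+1 == j :> nat) || (j.+1 == i :> nat).

(* The value at n = 0 is a convention: summing over the forests of the empty
   graph would give 1. *)
Definition path_Z (R : realType) (n : nat) (q : R) : R :=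
  if n is 0 then 0 else forest_Z (@path_graph n) q.

(* The first m steps of the simple random walk are uniform over the 2 ^ m
   sequences of signs; [srw_pos w] is S_m when [w] records these steps, with
   [true] for +1 and [false] for -1. *)
Definition srw_pos (m : nat) (w : {ffun 'I_m -> bool}) : int :=
  \sum_(k < m) (if w k then 1 else -1).

Definition srw_prob (R : realType) (m : nat) (A : pred int) : R :=
  #|[set w : {ffun 'I_m -> bool} | A (srw_pos w)]|%:R / 2 ^+ m.

(* Main.v *)
Require Import Defs.
From HB Require Import structures.
From mathcomp Require Import all_boot all_order all_algebra.
From mathcomp Require Import reals.
From mathcomp Require Import zify ring lra.
Set Implicit Arguments.
Unset Strict Implicit.
Unset Printing Implicit Defensive.
Import Order.TTheory GRing.Theory Num.Theory.
Local Open Scope ring_scope.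

(** Why the theorem holds.

    A rooted spanning forest of the path gives each vertex a letter: its
    outgoing edge goes right, goes left, or it is a root.  The words obtained
    are those in which no right is immediately followed by a left (that would
    be a directed 2-cycle) and which neither start with a left nor end with a
    right.  The edge between two consecutive vertices is in the forest exactly
    when the first letter is a right or the second a left, and two vertices are
    in the same tree exactly when all edges between them are.  So both the
    partition function and the weight of the event that x and y are in the same
    tree are sums over words of products of local weights, and a transfer
    matrix computes them.  It has two states: closed (the last letter is a left
    or a root) and open (the last letter is a right, and a root is still due).
    On an unconstrained stretch the matrix is [[1+q, 1], [q, 1]]; on a stretch
    whose edges must all be present it is [[1, 0], [q, 1]], whose d-th power
    contributes the factor d of the formula (word_sum_free_prefix,
    word_sum_linked_prefix, separation_prob_path).

    For the bounds, write q = 4 sinh^2(h) and w = e^h.  The recurrences are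
    solved by Z_n = q sinh(2nh)/sinh(2h) and
    Z_(k+1) - Z_k = q cosh((2k+1)h)/cosh(h) (path_sums_hyperbolic), so that the
    probability of being in the same tree becomes an explicit quotient of
    hyperbolic functions (same_ratio).  Both bounds go through the simple random
    walk killed with probability q/(2+q) at each step, which survives m steps
    with probability (2/(2+q))^m = cosh(2h)^(-m).  The functions
    k |-> cosh((2k+e)h) are harmonic for the killed walk.

    - Upper bound.  The killed walk started at x and reflected at the end of the
      path hits y with probability cosh((2x-1)h)/cosh((2y-1)h).  This is at most
      the probability that x and y share a tree (same_ratio_ge), and at least
      P(|S_m| > d) cosh(2h)^(-m) by the reflection principle (crossing_le).
    - Lower bound.  With r the least integer that is at least d/2, the walk
      started at 0 is killed before it exits the interval (-r, r) with
      probability 1 - 1/cosh(2rh).  The square of this is at most the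
      probability that x and y are separated (same_ratio_le), and it is at
      least (1 - cosh(2h)^(-m)) (2 P(|S_m| < r) - 1) because one way to be
      killed inside is to be killed within m steps and not to exit during them
      (staying_le).

    The two statements about the killed walk are proved without hitting times:
    the reflection principle expresses exit probabilities through the tails of
    S_m, these tails satisfy a one-step recurrence, and an induction on m
    compares them with the harmonic function. *)

(** * Forests of the path as words *)

Local Notation step := (option bool).
Local Notation rightward := (Some true).
Local Notation leftward := (Some false).
Local Notation halt := (@None bool).

Definition allowed (s u : step) := ~~ ((s == rightward) && (u == leftward)).
Definition linked (s u : step) := (s == rightward) || (u == leftward).

(** The vertex before the first one is given the letter right: forbidding a
    left after a right then also forbids a left on the first vertex. *)
Definition before n (t : n.-tuple step) k := nth rightward (rightward :: t) k.
Definition letter n (t : n.-tuple step) k := nth rightward t k.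

Definition admissible n (t : n.-tuple step) :=
  [forall k : 'I_n, allowed (before t k) (letter t k)]
  && (last rightward t != rightward).

Definition word_forest n (t : n.-tuple step) : {set 'I_n * 'I_n} :=
  [set a : 'I_n * 'I_n | (letter t a.1 == rightward) && (a.2 == a.1.+1 :> nat)
        || (letter t a.1 == leftward) && (a.1 == a.2.+1 :> nat)].

Definition forest_word n (F : {set 'I_n * 'I_n}) : n.-tuple step :=
  [tuple if [exists v, ((u, v) \in F) && (v == u.+1 :> nat)] then rightward
         else if [exists v, ((u, v) \in F) && (u == v.+1 :> nat)] then leftward
         else halt | u < n].

(** Both acyclicity and disconnectedness on a path are shown by cutting it
    at an edge; [a] is then one side of the cut. *)
Lemma connect_stable (T : finType) (e : rel T) (a : pred T) x y :
  (forall u v, e u v -> a u -> a v) -> connect e x y -> a x -> a y.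
Proof.
move=> ea /connectP[p ep ->]; elim: p x ep => [|z p IHp] x //=.
by case/andP=> xz zp ax; apply: IHp zp (ea _ _ xz ax).
Qed.

Section Words.
Variable n : nat.
Hypothesis n_gt0 : (0 < n)%N.
Implicit Types (t : n.-tuple step) (F : {set 'I_n * 'I_n}) (u v : 'I_n).

Lemma letter_forest_word F u : letter (forest_word F) u =
  if [exists v, ((u, v) \in F) && (v == u.+1 :> nat)] then rightward
  else if [exists v, ((u, v) \in F) && (u == v.+1 :> nat)] then leftward
  else halt.
Proof. by rewrite /letter -tnth_nth tnth_mktuple. Qed.

Lemma in_word_forest t u v : ((u, v) \in word_forest t) =
  (letter t u == rightward) && (v == u.+1 :> nat)
  || (letter t u == leftward) && (u == v.+1 :> nat).
Proof. by rewrite inE. Qed.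

Lemma arc_word_forest t u v : Defs.arc (word_forest t) u v =
  (letter t u == rightward) && (v == u.+1 :> nat)
  || (letter t u == leftward) && (u == v.+1 :> nat).
Proof. by rewrite -in_word_forest. Qed.

Lemma admissibleP t :
  reflect [/\ letter t 0 != leftward,
              forall k, (k.+1 < n)%N -> allowed (letter t k) (letter t k.+1)
            & letter t n.-1 != rightward] (admissible t).
Proof.
have last_letter : last rightward t = letter t n.-1.
  by rewrite -nth_last size_tuple.
apply: (iffP andP); rewrite last_letter.
  case=> /forallP okt endt; split=> // [|k kn].
    by have := okt (Ordinal n_gt0); rewrite /allowed /before /=.
  exact: okt (Ordinal kn).
case=> t0 okt endt; split=> //; apply/forallP=> -[[|k] kn] /=.
  by rewrite /allowed /before /=.
exact: okt.
Qed.

(** Out-degree at most one is what makes the word well defined: a vertex with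
    edges in both directions would be recorded as a right only. *)
Lemma forest_wordK F :
  rooted_spanning_forest (@path_graph n) F -> word_forest (forest_word F) = F.
Proof.
case/and3P=> /subsetP Fpath /forallP outF _; apply/setP=> -[u v].
have out_unique v1 v2 : (u, v1) \in F -> (u, v2) \in F -> v1 = v2.
  move=> F1 F2; have /card_le1_eqP/(_ (u, v1) (u, v2)) := outF u.
  by rewrite !inE F1 F2 eqxx => /(_ isT isT) [].
rewrite in_word_forest letter_forest_word; apply/idP/idP.
  case: existsP => [[w /andP[Fw /eqP wu]]|_] /=.
    by rewrite orbF => /eqP vu; rewrite (_ : v = w) //; apply/val_inj; rewrite /= wu.
  case: existsP => [[w /andP[Fw /eqP wu]]|_] //= /eqP vu.
  by rewrite (_ : v = w) //; apply/val_inj/succn_inj; rewrite -wu -vu.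
move=> Fuv; have := Fpath _ Fuv; rewrite inE /path_graph /=.
case/orP=> /eqP uv.
  case: existsP => [_|noR]; first by rewrite uv !eqxx.
  by case: noR; exists v; rewrite Fuv uv eqxx.
case: existsP => [[w /andP[Fw /eqP wu]]|_] /=.
  by have := out_unique _ _ Fuv Fw; move: wu; rewrite -uv => + vw; rewrite vw; lia.
case: existsP => [_|noL]; first by rewrite uv !eqxx.
by case: noL; exists v; rewrite Fuv uv eqxx.
Qed.

Lemma word_forestK t : admissible t -> forest_word (word_forest t) = t.
Proof.
case/admissibleP=> t0 _ tn; apply: eq_from_tnth => u.
rewrite !(tnth_nth rightward) -!/(letter _ u) letter_forest_word.
case: existsP => [[v]|noR].
  rewrite in_word_forest => /andP[] /orP[/andP[/eqP-> //]|] /andP[_ /eqP-> /eqP].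
  by lia.
case: existsP => [[v]|noL].
  rewrite in_word_forest => /andP[] /orP[|/andP[/eqP-> //]] /andP[_ /eqP-> /eqP].
  by lia.
case Eu: (letter t u) => [[]|] //.
  case: noR; have [un|nu] := ltnP u.+1 n.
    by exists (Ordinal un); rewrite in_word_forest Eu /= !eqxx.
  case/negP: tn; rewrite -Eu; apply/eqP; congr letter.
  by have := ltn_ord u; lia.
case: noL; case: (posnP u) => [u0|u_gt0]; first by rewrite -u0 Eu in t0.
have u'n : (u.-1 < n)%N by have := ltn_ord u; lia.
by exists (Ordinal u'n); rewrite in_word_forest Eu /= prednK // !eqxx.
Qed.

(** A directed cycle through the edge u -> u+1 would have to return from the
    vertices above u, which only a left at u+1 allows, and a left cannot follow
    the right at u; the case of an edge u+1 -> u is symmetric. *)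
Lemma word_forest_spanning t :
  admissible t -> rooted_spanning_forest (@path_graph n) (word_forest t).
Proof.
case/admissibleP=> _ okt _; apply/and3P; split.
- apply/subsetP=> -[u v]; rewrite in_word_forest inE /path_graph /=.
  by case/orP=> /andP[_ /eqP->]; rewrite eqxx ?orbT.
- apply/forallP=> u; apply/card_le1_eqP=> -[u1 v1] [u2 v2].
  rewrite !inE /= => /andP[uv1 /eqP u1E] /andP[uv2 /eqP u2E].
  move: uv1 uv2; rewrite {}u1E {}u2E => uv1 uv2.
  congr (_, _); apply/val_inj; move: uv1 uv2 => /=.
  by case: (letter t u) => [[]|] //=; rewrite ?orbF => /eqP E1 /eqP E2; lia.
apply/forallP=> u; apply/forallP=> v; apply/implyP; rewrite arc_word_forest.
have no_return (a b : 'I_n) : b = a.+1 :> nat ->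
    letter t a = rightward -> letter t b = leftward -> False.
  move=> ba ta tb; have := okt a; rewrite -ba tb ta => /(_ (ltn_ord b)).
  by rewrite /allowed !eqxx.
case/orP=> /andP[/eqP tu /eqP uv]; apply/negP.
  move/(@connect_stable _ _ (fun w : 'I_n => u < w)%N); rewrite uv ltnn ltnSn.
  case/(_ _ isT)/notF => w w'; rewrite arc_word_forest.
  case/orP=> /andP[/eqP tw /eqP ww'] uw; first by lia.
  have [//|w'u] := ltnP u w'.
  by case: (no_return u w) => //; lia.
move/(@connect_stable _ _ (fun w : 'I_n => w < u)%N); rewrite uv ltnn ltnSn.
case/(_ _ isT)/notF => w w'; rewrite arc_word_forest.
case/orP=> /andP[/eqP tw /eqP ww'] uw; last by lia.
have [//|w'u] := ltnP w' v.+1.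
by case: (no_return w u) => //; lia.
Qed.

(** Decoding drops the edges that would leave the path, so a word that
    survives encoding its forest has no such letter at either end; the
    2-cycle of a right followed by a left contradicts acyclicity. *)
Lemma spanning_word_forest t :
  rooted_spanning_forest (@path_graph n) (word_forest t) ->
  forest_word (word_forest t) = t -> admissible t.
Proof.
case/and3P=> _ _ /forallP acF tK; apply/admissibleP; split.
- have := letter_forest_word (word_forest t) (Ordinal n_gt0); rewrite tK /= => ->.
  case: existsP => // _; case: existsP => // -[v /andP[_]] //.
- move=> k kn; rewrite /allowed; apply/negP=> /andP[tk tk1].
  have uv : Defs.arc (word_forest t) (Ordinal (ltnW kn)) (Ordinal kn).
    by rewrite arc_word_forest /= tk eqxx.
  have vu : Defs.arc (word_forest t) (Ordinal kn) (Ordinal (ltnW kn)).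
    by rewrite arc_word_forest /= tk1 eqxx orbT.
  have /forallP/(_ (Ordinal kn)) := acF (Ordinal (ltnW kn)).
  by rewrite uv /= connect1.
have n'n : (n.-1 < n)%N by rewrite prednK.
have := letter_forest_word (word_forest t) (Ordinal n'n); rewrite tK /= => ->.
case: existsP => [[v /andP[_ /eqP]]|_]; last by case: ifP.
by rewrite prednK // => vn; have := ltn_ord v; rewrite vn ltnn.
Qed.

Lemma roots_word_forest t : admissible t ->
  Defs.roots (word_forest t) = [set u : 'I_n | letter t u == halt].
Proof.
move=> okt; apply/setP=> u; rewrite !inE; apply/eqP/eqP => [out0|tu].
  have := letter_forest_word (word_forest t) u; rewrite word_forestK // => ->.
  have noF v : (u, v) \in word_forest t = false.
    by apply/negP=> Fuv; have := in_set0 (u, v); rewrite -out0 inE Fuv eqxx.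
  by case: existsP => [[v]|_]; last case: existsP => [[v]|_] //; rewrite noF.
apply/setP=> -[a v]; rewrite in_set0 inE in_word_forest /=.
by apply/negP=> /andP[av /eqP au]; move: av; rewrite au tu.
Qed.

(** A missing edge splits the path into two parts between which the forest has
    no edge at all, since its edges join consecutive vertices. *)
Lemma same_tree_word t (i j : 'I_n) : (i < j)%N ->
  same_tree (word_forest t) i j =
  [forall k : 'I_n, (i < k <= j)%N ==> linked (before t k) (letter t k)].
Proof.
move=> ij; apply/idP/forallP => [st k|lk].
  apply/implyP=> /andP[ik kj]; apply/contraLR: st => nlk; apply/negP.
  move/(@connect_stable _ _ (fun w : 'I_n => w < k)%N).
  rewrite ik ltnNge kj => /(_ _ isT)/notF; apply => u v /=.
  rewrite /= !arc_word_forest => uv uk; have [//|kv] := ltnP v k.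
  case/negP: nlk; rewrite /linked.
  have [Ek Eu] : k = v :> nat /\ k = u.+1 :> nat.
    by case/orP: uv => /orP[] /andP[_ /eqP]; lia.
  rewrite Eu /before /= -/(letter t u) -Eu Ek.
  by case/orP: uv => /orP[] /andP[tw /eqP E]; rewrite ?tw ?orbT //; lia.
have step_edge (u v : 'I_n) : v = u.+1 :> nat -> (i <= u)%N -> (v <= j)%N ->
    same_tree (word_forest t) u v.
  move=> vu iu vj; apply: connect1; rewrite /= !arc_word_forest vu eqxx !andbT.
  have /implyP := lk v; rewrite vu ltnS iu -vu vj => /(_ isT).
  by rewrite /linked vu /before /= => /orP[-> | ->]; rewrite ?orbT.
have [d jE] : exists d, j = (i + d)%N :> nat.
  by exists (j - i)%N; rewrite subnKC // ltnW.
have {lk}: forall d' (v : 'I_n), v = (i + d')%N :> nat -> (v <= j)%N ->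
    same_tree (word_forest t) i v.
  elim=> [|d' IHd] v vE vj.
    by rewrite (_ : v = i) ?/same_tree ?connect0 //; apply/val_inj; rewrite /= vE addn0.
  have v'n : (i + d' < n)%N by have := ltn_ord v; lia.
  apply: connect_trans (IHd (Ordinal v'n) erefl _) (step_edge _ _ _ _ _) => //=; lia.
by move/(_ d j jE (leqnn _)).
Qed.

End Words.

(** * Transfer matrix *)

Lemma big_tuple_recl (V : nmodType) (T : finType) n (G : n.+1.-tuple T -> V) :
  \sum_t G t = \sum_(s : T) \sum_(t : n.-tuple T) G [tuple of s :: t].
Proof.
rewrite pair_big /= (reindex (fun p : T * n.-tuple T => [tuple of p.1 :: p.2])) //.
exists (fun t => (thead t, [tuple of behead t])) => [[s t] _|t _] /=.
  by congr (_, _); apply/val_inj.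
by rewrite [RHS]tuple_eta.
Qed.

Section Transfer.
Variables (R : realType) (q : R).
Implicit Types (must_link : pred nat) (s u : step).

Definition step_weight (b : bool) s u : R :=
  if allowed s u && (b ==> linked s u) then if u == halt then q else 1 else 0.

(** Total weight of the words that can follow the letter [s], with the edge
    entering position k required to be in the forest when [must_link k].  The
    factor on the last letter excludes a right with no vertex to point to; for
    the empty word it makes the weight of the open state 0, which agrees with
    the convention for the partition function of the empty path. *)
Definition word_sum must_link n s : R :=
  \sum_(t : n.-tuple step)
     \prod_(k < n) step_weight (must_link k) (nth s (s :: t) k) (nth s t k)
     * (last s t != rightward)%:R.

Lemma word_sum0 must_link s : word_sum must_link 0 s = (s != rightward)%:R.
Proof.
rewrite /word_sum (big_pred1 [tuple]) ?big_ord0 ?mul1r // => t.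
by rewrite [t]tuple0.
Qed.

Lemma word_sumS must_link n s : word_sum must_link n.+1 s =
  \sum_u step_weight (must_link 0) s u * word_sum (fun k => must_link k.+1) n u.
Proof.
rewrite /word_sum big_tuple_recl; apply: eq_bigr => u _.
rewrite mulr_sumr; apply: eq_bigr => t _; rewrite big_ord_recl mulrA.
congr (_ * _ * _); apply: eq_bigr => k _ /=.
by rewrite add0n !(set_nth_default u) //= size_tuple // ltnS ltnW.
Qed.

Lemma eq_word_sum f g n s :
  (forall k, (k < n)%N -> f k = g k) -> word_sum f n s = word_sum g n s.
Proof.
move=> fg; apply: eq_bigr => t _; congr (_ * _).
by apply: eq_bigr => k _; rewrite fg.
Qed.

(** Unconstrained sums over the continuations of a closed state, respectively of
    an open state.  A fresh path starts in the open state, because of its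
    fictitious right letter, so [open_sum] is its partition function. *)
Definition closed_sum n := word_sum xpred0 n halt.
Definition open_sum n := word_sum xpred0 n rightward.

Lemma sum_steps (G : step -> R) :
  \sum_u G u = G rightward + (G leftward + G halt).
Proof.
rewrite (bigD1 rightward) //= (bigD1 leftward) //= (big_pred1 halt) //.
by case=> [[]|].
Qed.

(** A left and a root restrict what follows in the same way, so that the matrix
    is 2 by 2. *)
Lemma closed_state must_link n :
  word_sum must_link n leftward = word_sum must_link n halt.
Proof.
case: n => [|n]; first by rewrite !word_sum0.
by rewrite !word_sumS.
Qed.

Lemma word_sum_free_step must_link n : must_link 0 = false ->
  let c := word_sum (fun k => must_link k.+1) n halt in
  let o := word_sum (fun k => must_link k.+1) n rightward in
  word_sum must_link n.+1 halt = (1 + q) * c + o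
  /\ word_sum must_link n.+1 rightward = q * c + o.
Proof.
by move=> ml0; rewrite !word_sumS !sum_steps !closed_state ml0 /step_weight /=;
  split; ring.
Qed.

Lemma word_sum_linked_step must_link n : must_link 0 ->
  let c := word_sum (fun k => must_link k.+1) n halt in
  let o := word_sum (fun k => must_link k.+1) n rightward in
  word_sum must_link n.+1 halt = c
  /\ word_sum must_link n.+1 rightward = o + q * c.
Proof.
by move=> ml0; rewrite !word_sumS !sum_steps !closed_state ml0 /step_weight /=;
  split; ring.
Qed.

Lemma closed_sum0 : closed_sum 0 = 1.
Proof. by rewrite /closed_sum word_sum0. Qed.

Lemma open_sum0 : open_sum 0 = 0.
Proof. by rewrite /open_sum word_sum0. Qed.

Lemma open_sumS n : open_sum n.+1 = open_sum n + q * closed_sum n.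
Proof.
by rewrite /open_sum; have [_ ->] := @word_sum_free_step xpred0 n erefl; rewrite addrC.
Qed.

Lemma closed_sumS n : closed_sum n.+1 = closed_sum n + open_sum n.+1.
Proof.
rewrite open_sumS /closed_sum; have [-> _] := @word_sum_free_step xpred0 n erefl.
by rewrite -/(closed_sum n) -/(open_sum n) /=; ring.
Qed.

(** The x-th power of the free transfer matrix has entries that are themselves
    free sums, since its recurrence is the one that these sums obey. *)
Lemma word_sum_free_prefix must_link x n : q != 0 ->
  (forall k, (k < x)%N -> must_link k = false) ->
  let c := word_sum (fun k => must_link (x + k)%N) n halt in
  let o := word_sum (fun k => must_link (x + k)%N) n rightward in
  word_sum must_link (x + n) halt = closed_sum x * c + open_sum x / q * o
  /\ word_sum must_link (x + n) rightward
     = open_sum x * c + (closed_sum x - open_sum x) * o.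
Proof.
move=> q0; elim: x must_link => [|x IHx] must_link free /=.
  by rewrite closed_sum0 open_sum0 !mul0r !mul1r subr0 !mul1r addr0 add0r.
have [|-> ->] := @word_sum_free_step must_link (x + n); first exact: free.
have [|-> ->] := IHx (fun k => must_link k.+1); first by move=> k kx; apply: free.
rewrite closed_sumS !open_sumS.
by split; field.
Qed.

(** Through linked edges a closed state can only see lefts, while an open state
    either stays open or places its root at one of the d positions; this choice
    is the origin of the factor d. *)
Lemma word_sum_linked_prefix must_link d n :
  (forall k, (k < d)%N -> must_link k) ->
  let c := word_sum (fun k => must_link (d + k)%N) n halt in
  let o := word_sum (fun k => must_link (d + k)%N) n rightward in
  word_sum must_link (d + n) halt = c
  /\ word_sum must_link (d + n) rightward = o + d%:R * q * c.
Proof.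
elim: d must_link => [|d IHd] must_link link /=.
  by rewrite !mul0r addr0.
have [|-> ->] := @word_sum_linked_step must_link (d + n); first exact: link.
have [|-> ->] := IHd (fun k => must_link k.+1); first by move=> k kx; apply: link.
by split=> //; rewrite -natr1; ring.
Qed.

Lemma sum_forests_words n must_link (A : pred {set 'I_n * 'I_n}) : (0 < n)%N ->
  (forall t, admissible t -> A (word_forest t) =
     [forall k : 'I_n, must_link k ==> linked (before t k) (letter t k)]) ->
  \sum_(F | rooted_spanning_forest (@path_graph n) F && A F) q ^+ #|Defs.roots F|
  = word_sum must_link n rightward.
Proof.
move=> n_gt0 AE; rewrite (reindex_onto (@word_forest n) (@forest_word n)); last first.
  by move=> F /andP[rsfF _]; apply: forest_wordK.
rewrite big_mkcond; apply: eq_bigr => t _.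
set B := [forall k : 'I_n, must_link k ==> linked (before t k) (letter t k)].
rewrite (_ : _ && _ = admissible t && B); last first.
  apply/andP/andP=> [[/andP[rsf At] /eqP tK]|[okt Bt]].
    by have okt := spanning_word_forest n_gt0 rsf tK; rewrite /B -AE.
  by rewrite word_forest_spanning // word_forestK // AE.
rewrite -/(before t _).
have -> : \prod_(k < n) step_weight (must_link k) (before t k) (letter t k) =
    if [forall k : 'I_n, allowed (before t k) (letter t k)] && B
    then q ^+ #|[set u : 'I_n | letter t u == halt]| else 0.
  case: ifPn => [/andP[/forallP al /forallP li]|].
    rewrite -prodr_const [RHS]big_mkcond; apply: eq_bigr => k _.
    by rewrite /step_weight al li inE.
  rewrite negb_and => /orP[] /forallPn[k nk]; apply/eqP/prodf_eq0; exists k => //.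
    by rewrite /step_weight (negPf nk).
  by rewrite /step_weight (negPf nk) andbF.
rewrite andbC /admissible andbA [B && _]andbC.
have [lastR|lastNR] := eqVneq (last rightward t) rightward.
  by rewrite andbF mulr0.
rewrite andbT mulr1; case: ifP => // /andP[al _].
by rewrite roots_word_forest // /admissible al lastNR.
Qed.

Lemma path_Z_open_sum n : path_Z n q = open_sum n.
Proof.
case: n => [|n]; first by rewrite open_sum0.
rewrite /path_Z /forest_Z /open_sum -(@sum_forests_words _ _ predT) //.
  by apply: eq_bigl => F; rewrite andbT.
by move=> t _; apply/esym/forallP.
Qed.

Hypothesis q_gt0 : 0 < q.

Lemma closed_open_sum_gt0 n : 0 < closed_sum n /\ 0 <= open_sum n.
Proof.
elim: n => [|n [cl_gt0 op_ge0]]; first by rewrite closed_sum0 open_sum0.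
have op_gt0 : 0 <= open_sum n.+1 by rewrite open_sumS addr_ge0 // mulr_ge0 // ltW.
by rewrite closed_sumS ltr_wpDr.
Qed.

Lemma open_sum_gt0 n : (0 < n)%N -> 0 < open_sum n.
Proof.
case: n => // n _; have [cl_gt0 op_ge0] := closed_open_sum_gt0 n.
by rewrite open_sumS ltr_wpDl // mulr_gt0.
Qed.

(** A word of the same-tree event consists of i + 1 free letters, d linked ones
    and l free ones.  Multiplying the three transfer matrices, the terms
    without d recombine into the partition function of the path in which the
    segment from u to v is contracted to a point. *)
Lemma separation_prob_path i d l n (u v : 'I_n) :
  u = i :> nat -> v = (i + d)%N :> nat -> n = (i + d + l).+1 -> (0 < d)%N ->
  separation_prob (@path_graph n) q u v =
  1 - (open_sum (i + l).+1 + d%:R * q * closed_sum i * closed_sum l) / open_sum n.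
Proof.
move=> ui vid nE d_gt0; have n_gt0 : (0 < n)%N by rewrite nE.
have Z_gt0 := open_sum_gt0 n_gt0; have q0 : q != 0 by rewrite gt_eqF.
have uv : (u < v)%N by rewrite ui vid -addn1 leq_add2l.
pose window k := (i < k <= i + d)%N.
have same_sum : \sum_(F | rooted_spanning_forest (@path_graph n) F
                          && same_tree F u v) q ^+ #|Defs.roots F|
    = open_sum (i + l).+1 + d%:R * q * closed_sum i * closed_sum l.
  rewrite (@sum_forests_words _ window) //; last first.
    by move=> t okt; rewrite same_tree_word // ui vid.
  rewrite (_ : n = i.+1 + (d + l))%N; last by rewrite nE addSn addnA.
  have [|_ ->] := @word_sum_free_prefix window i.+1 (d + l) q0.
    by move=> k ki; rewrite /window; lia.
  have [|-> ->] := @word_sum_linked_prefix (fun k => window (i.+1 + k)%N) d l.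
    by move=> k kd; rewrite /window; lia.
  have tail s : word_sum (fun k => window (i.+1 + (d + k))%N) l s = word_sum xpred0 l s.
    by apply: eq_word_sum => k _; rewrite /window; lia.
  rewrite !tail -/(closed_sum l) -/(open_sum l).
  (* The sum for the contracted path, split after its first i + 1 letters. *)
  have [|_] := @word_sum_free_prefix xpred0 i.+1 l q0; first by [].
  rewrite addSn -!/(open_sum _) => ->; rewrite -/(closed_sum l) closed_sumS.
  by ring.
rewrite -same_sum /separation_prob /forest_prob.
have ZE : forest_Z (@path_graph n) q = open_sum n.
  by rewrite -path_Z_open_sum; move: (n) n_gt0 => [].
apply/eqP; rewrite eq_sym subr_eq /forest_law ZE -!mulr_suml -mulrDl.
rewrite eq_sym -[X in _ == X](divff (lt0r_neq0 Z_gt0)); apply/eqP; congr (_ / _).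
rewrite -ZE /forest_Z [RHS](bigID (fun F => same_tree F u v)).
by rewrite addrC.
Qed.
End Transfer.

(** * Hyperbolic closed forms *)

Section Hyperbolic.
Variables (R : realType) (w : R).
Hypothesis w_gt1 : 1 < w.
Implicit Types (k l : int) (n d : nat).

(** With w = e^h these are cosh(kh) and sinh(kh).  The parameter h is half of
    the angle that solves the recurrence, because the odd multiples of h occur
    as well. *)
Definition ch k : R := (w ^ k + w ^ (- k)) / 2.
Definition sh k : R := (w ^ k - w ^ (- k)) / 2.

Let w_neq0 : w != 0.
Proof. by rewrite gt_eqF // (lt_trans ltr01). Qed.

Lemma chN k : ch (- k) = ch k.
Proof. by rewrite /ch opprK addrC. Qed.

Lemma shN k : sh (- k) = - sh k.
Proof. by rewrite /sh opprK -mulNr opprB. Qed.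

Lemma chD k l : ch (k + l) = ch k * ch l + sh k * sh l.
Proof. by rewrite /ch /sh opprD !expfzDr //; field. Qed.

Lemma shD k l : sh (k + l) = sh k * ch l + ch k * sh l.
Proof. by rewrite /ch /sh opprD !expfzDr //; field. Qed.

Lemma ch0 : ch 0 = 1.
Proof. by rewrite /ch oppr0 expr0z; field. Qed.

Lemma sh0 : sh 0 = 0.
Proof. by rewrite /sh oppr0 subrr mul0r. Qed.

Lemma ch_sh k : ch k ^+ 2 - sh k ^+ 2 = 1.
Proof. by rewrite -ch0 -(subrr k) chD chN shN; ring. Qed.

Lemma ch_gt0 k : 0 < ch k.
Proof. by rewrite divr_gt0 // addr_gt0 // exprz_gt0 // (lt_trans ltr01). Qed.

Lemma ch_ge1 k : 1 <= ch k.
Proof.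
rewrite -(@ler_pXn2r _ 2) ?nnegrE ?ler01 ?(ltW (ch_gt0 _)) // expr1n.
by rewrite -(ch_sh k) lerBlDr lerDl sqr_ge0.
Qed.

Lemma sh1_gt0 : 0 < sh 1.
Proof.
rewrite divr_gt0 // subr_gt0 -invr_expz expr1z.
by rewrite (lt_trans _ w_gt1) // invf_lt1 // (lt_trans ltr01).
Qed.

Lemma sh_ge_linear n : n%:R * sh 1 <= sh n.
Proof.
elim: n => [|n IHn]; first by rewrite mul0r sh0.
rewrite -natr1 mulrDl mul1r -addn1 PoszD shD.
have sh_ge0 : 0 <= sh n by apply: le_trans IHn; rewrite mulr_ge0 // ltW ?sh1_gt0.
by rewrite lerD // ?(le_trans IHn) ?ler_peMr ?ler_peMl ?ch_ge1 // ltW // sh1_gt0.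
Qed.

Lemma sh_ge0 n : 0 <= sh n.
Proof. by apply: le_trans (sh_ge_linear n); rewrite mulr_ge0 // ltW ?sh1_gt0. Qed.

Lemma sh_gt0 n : (0 < n)%N -> 0 < sh n.
Proof.
move=> n_gt0; apply: lt_le_trans (sh_ge_linear n).
by rewrite mulr_gt0 ?ltr0n // sh1_gt0.
Qed.

Lemma ch_homo m n : (m <= n)%N -> ch m <= ch n.
Proof.
move=> mn; rewrite -(subnKC mn) PoszD chD.
by rewrite (le_trans (ler_peMr (ltW (ch_gt0 _)) (ch_ge1 (n - m)%N))) // lerDl mulr_ge0 // sh_ge0.
Qed.

Lemma sh2E : sh 2 = 2 * sh 1 * ch 1.
Proof. by rewrite -[X in sh X]/(1 + 1) shD; ring. Qed.

Lemma ch2E : ch 2 = 1 + 2 * sh 1 ^+ 2.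
Proof. by rewrite -[X in ch X]/(1 + 1) chD; move: (ch_sh 1); lra. Qed.

Lemma ch_harmonic k : ch (k + 2) + ch (k - 2) = 2 * ch 2 * ch k.
Proof. by rewrite (chD k 2) (chD k (- 2)) chN shN; ring. Qed.

Let q : R := 4 * sh 1 ^+ 2.

(** With q = 4 sinh^2(h), both recurrences are the sum-to-product formulas for
    sinh((m+1)h) - sinh((m-1)h) and cosh((m+1)h) - cosh((m-1)h). *)
Lemma path_sums_hyperbolic n :
  open_sum q n = q * sh (2 * n)%N / sh 2
  /\ closed_sum q n = ch (2 * n + 1)%N / ch 1.
Proof.
have ch1_neq0 : ch 1 != 0 by rewrite gt_eqF // ch_gt0.
have sh1_neq0 : sh 1 != 0 by rewrite gt_eqF // sh1_gt0.
elim: n => [|n [opn cln]].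
  by rewrite open_sum0 closed_sum0 muln0 sh0 add0n divff //; split; ring.
have opn1 : open_sum q n.+1 = q * sh (2 * n.+1)%N / sh 2.
  rewrite open_sumS opn cln; set m : int := (2 * n + 1)%N.
  have -> : (2 * n.+1)%N = m + 1 :> int by lia.
  have -> : (2 * n)%N = m - 1 :> int by lia.
  rewrite sh2E !shD chN shN.
  by field; rewrite ch1_neq0.
split=> //; rewrite closed_sumS opn1 cln; set m : int := (2 * n.+1)%N.
have -> : (2 * n.+1 + 1)%N = m + 1 :> int by lia.
have -> : (2 * n + 1)%N = m - 1 :> int by lia.
rewrite sh2E !chD chN shN /q.
by field; rewrite ch1_neq0.
Qed.

(** The probability that two vertices at distance d in a path are in the same
    tree, with i vertices before the first and l after the second. *)
Definition same_ratio (i d l : nat) : R :=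
  (sh ((2 * i + 1) + (2 * l + 1))%N
   + (2 * d)%:R * (sh 1 / ch 1) * ch (2 * i + 1)%N * ch (2 * l + 1)%N)
  / sh ((2 * i + 1) + (2 * l + 1) + 2 * d)%N.

Lemma same_ratioE (i d l : nat) :
  (open_sum q (i + l).+1 + d%:R * q * closed_sum q i * closed_sum q l)
    / open_sum q (i + d + l).+1 = same_ratio i d l.
Proof.
have ch1_neq0 : ch 1 != 0 by rewrite gt_eqF // ch_gt0.
have sh1_neq0 : sh 1 != 0 by rewrite gt_eqF // sh1_gt0.
have [_ ->] := path_sums_hyperbolic i; have [_ ->] := path_sums_hyperbolic l.
have [-> _] := path_sums_hyperbolic (i + l).+1.
have [-> _] := path_sums_hyperbolic (i + d + l).+1.
rewrite /same_ratio.
have -> : (2 * i + 1 + (2 * l + 1) = 2 * (i + l).+1)%N by lia.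
have -> : (2 * (i + l).+1 + 2 * d = 2 * (i + d + l).+1)%N by lia.
have : sh (2 * (i + d + l).+1)%N != 0 by rewrite gt_eqF // sh_gt0.
set S := sh _ => S0; set S' := sh (Posz _).
rewrite sh2E natrM /q.
by field; rewrite S0 ch1_neq0.
Qed.

(** Write sinh(2dh) = 2 sinh(dh) cosh(dh) and use sinh(dh) >= d sinh(h); there
    remains 1 + cosh(2rh) <= 2 cosh(h) cosh(dh) = cosh((d-1)h) + cosh((d+1)h),
    which holds term by term when 2r <= d + 1. *)
Lemma cosh_window_le (r d : nat) : (0 < d)%N -> (2 * r <= d.+1)%N ->
  d%:R * (sh 1 / ch 1) * (1 + ch (2 * r)%N) <= sh (2 * d)%N.
Proof.
case: d => // d _ rd.
have -> : (2 * d.+1)%N = d.+1%:Z + d.+1%:Z :> int by lia.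
rewrite shD mulrAC mulrA ler_pdivrMr ?ch_gt0 //.
have ch_le : 1 + ch (2 * r)%N <= 2 * ch 1 * ch d.+1.
  have -> : 2 * ch 1 * ch d.+1 = ch d + ch d.+2.
    have -> : d = d.+1%:Z - 1 :> int by lia.
    have -> : d.+2 = d.+1%:Z + 1 :> int by lia.
    by rewrite !chD chN shN; ring.
  by rewrite lerD ?ch_ge1 // ch_homo.
apply: (@le_trans _ _ (sh d.+1 * (2 * ch 1 * ch d.+1))); last by lra.
rewrite mulrAC ler_pM ?sh_ge_linear //; first by rewrite mulr_ge0 // ltW ?sh1_gt0.
by rewrite addr_ge0 // ltW // ch_gt0.
Qed.

(** With K = cosh(2rh) the right-hand side is X = (2K - 1)/K^2.  Expanding the
    denominator of [same_ratio] by the addition formula, the two terms of the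
    numerator are compared with one term each: X cosh(2dh) >= 1 because
    cosh(2dh) >= K and X K >= 1, and X sinh(2dh) >= 2 d tanh(h) by
    [cosh_window_le] because X (1 + K) >= 2; finally
    cosh(a + b) >= cosh(a) cosh(b). *)
Lemma same_ratio_le (r i d l : nat) : (0 < d)%N -> (2 * r <= d.+1)%N ->
  same_ratio i d l <= 1 - (1 - (ch (2 * r)%N)^-1) ^+ 2.
Proof.
move=> d_gt0 rd; rewrite /same_ratio !PoszD.
set K := ch (2 * r)%N; set a : int := Posz (2 * i) + 1; set b : int := Posz (2 * l) + 1.
have K_ge1 : 1 <= K by apply: ch_ge1.
have K_gt0 : 0 < K by apply: ch_gt0.
have KC : K <= ch (2 * d)%N by apply: ch_homo; lia.
have KS := cosh_window_le d_gt0 rd.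
have [A_gt0 B_gt0] := (ch_gt0 a, ch_gt0 b).
have Sa : 0 <= sh a by apply: sh_ge0 (2 * i + 1)%N.
have Sb : 0 <= sh b by apply: sh_ge0 (2 * l + 1)%N.
have Sd : 0 < sh (2 * d)%N by apply: sh_gt0; lia.
have t_ge0 : 0 <= sh 1 / ch 1 by rewrite divr_ge0 // ltW ?ch_gt0 ?sh1_gt0.
have Sdt : 0 < sh (a + b + (2 * d)%N).
  by apply: (@sh_gt0 (2 * i + 1 + (2 * l + 1) + 2 * d)); lia.
rewrite ler_pdivrMr // natrM [sh (_ + Posz (2 * d))]shD.
move: KS t_ge0 Sd KC; set t := sh 1 / ch 1; set S := sh (2 * d)%N; set C := ch (2 * d)%N.
move=> KS t_ge0 Sd KC.
set X := 1 - _ ^+ 2.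
have XK : X * K ^+ 2 = 2 * K - 1 by rewrite /X; field; rewrite gt_eqF.
have X_gt0 : 0 < X by rewrite -(pmulr_lgt0 _ (exprn_gt0 2 K_gt0)) XK; lra.
have XC : 1 <= X * C.
  apply: (@le_trans _ _ (X * K)); last by rewrite ler_pM2l.
  by rewrite -(ler_pM2r K_gt0) mul1r -mulrA -expr2 XK; lra.
have X1K : 2 <= X * (1 + K).
  rewrite -(ler_pM2r (exprn_gt0 2 K_gt0)) mulrAC XK; nra.
have XS : 2 * d%:R * t <= X * S.
  apply: (@le_trans _ _ (X * (1 + K) * (d%:R * t))).
    by rewrite -mulrA ler_wpM2r // mulr_ge0.
  by rewrite -mulrA [(1 + K) * _]mulrC ler_pM2l.
rewrite mulrDr lerD //.
  rewrite mulrCA ler_peMr // shD addr_ge0 // mulr_ge0 // ltW //.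
apply: (@le_trans _ _ (X * S * (ch a * ch b))).
  by rewrite -[leLHS]mulrA ler_wpM2r // mulr_ge0 // ltW.
rewrite [leRHS]mulrCA mulrC ler_wpM2r //; first by rewrite mulr_ge0 // ltW.
by rewrite chD lerDl mulr_ge0.
Qed.

(** Telescoping: sinh(2dh) is the sum over k < d of 2 sinh(h) cosh((2k+1)h), and
    each of these d terms is at most the one with 2k + 1 replaced by 2d + 1. *)
Lemma sh_le_ch_sum (d : nat) : sh (2 * d)%N <= (2 * d)%:R * sh 1 * ch (2 * d + 1)%N.
Proof.
elim: d => [|d IHd]; first by rewrite !muln0 sh0 !mul0r.
set m : int := (2 * d + 1)%N.
have mono : ch m <= ch (2 * d.+1 + 1)%N by apply: ch_homo; lia.
have -> : sh (2 * d.+1)%N = sh (2 * d)%N + 2 * sh 1 * ch m.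
  have -> : (2 * d.+1)%N = m + 1 :> int by lia.
  have -> : (2 * d)%N = m - 1 :> int by lia.
  by rewrite !shD chN shN; ring.
have -> : (2 * d.+1)%:R = (2 * d)%:R + 2 :> R by rewrite mulnSr natrD.
rewrite -/m in IHd; move: (2 * d)%:R (ler0n R (2 * d)) mono IHd sh1_gt0.
move: (ch m) (ch (2 * d.+1 + 1)%N) (sh 1) (sh (2 * d)%N).
move=> c c' s S D D_ge0 cc' le_S s_gt0.
rewrite [leRHS]mulrAC (mulrDl D) (mulrDl (D * _)) lerD //.
  by rewrite mulrAC; apply: (le_trans le_S); rewrite ler_wpM2l // mulr_ge0 // ltW.
by rewrite mulrAC ler_pM2r // ler_pM2l.
Qed.

(** The left-hand side is the probability that the killed walk from the first
    vertex reaches the second one before dying.  After clearing denominators,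
    the difference of the two sides factors through
    2 d sinh(h) cosh(a + 2d) cosh(a)/cosh(h) - sinh(2d) (arguments of the
    functions in units of h, and a = 2i + 1), to which [sh_le_ch_sum] applies. *)
Lemma same_ratio_ge (i d l : nat) :
  ch (2 * i + 1)%N / ch (2 * (i + d) + 1)%N <= same_ratio i d l.
Proof.
rewrite /same_ratio; set a : int := (2 * i + 1)%N; set b : int := (2 * l + 1)%N.
set D : int := (2 * d)%N.
have -> : (2 * (i + d) + 1)%N = a + D :> int by lia.
have -> : (2 * i + 1 + (2 * l + 1) + 2 * d)%N = a + D + b :> int by lia.
have -> : (2 * i + 1 + (2 * l + 1))%N = a + b :> int by lia.
have S_gt0 : 0 < sh (a + D + b).
  by apply: (@sh_gt0 (2 * i + 1 + 2 * d + (2 * l + 1))); lia.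
rewrite ler_pdivrMr ?ch_gt0 // mulrAC ler_pdivlMr // -subr_ge0.
have -> : (sh (a + b) + (2 * d)%:R * (sh 1 / ch 1) * ch a * ch b) * ch (a + D)
    - ch a * sh (a + D + b)
  = ch b * ((2 * d)%:R * sh 1 * ch (a + D) * (ch a / ch 1) - sh D).
  have -> : sh D = sh (a + D) * ch a - ch (a + D) * sh a.
    have -> : sh D = sh (a + D + - a) by rewrite addrAC subrr add0r.
    by rewrite (shD (a + D)) chN shN; ring.
  by rewrite (shD a b) (shD (a + D) b); ring.
rewrite mulr_ge0 ?(ltW (ch_gt0 _)) // subr_ge0.
apply: (le_trans (sh_le_ch_sum d)).
have mono : ch (2 * d + 1)%N <= ch (a + D).
  by apply: (@ch_homo _ (2 * i + 1 + 2 * d)); lia.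
have ch1a : 1 <= ch a / ch 1.
  by rewrite ler_pdivlMr ?ch_gt0 // mul1r; apply: (@ch_homo 1 (2 * i + 1)); lia.
have s1 := ltW sh1_gt0; apply: (@le_trans _ _ ((2 * d)%:R * sh 1 * ch (a + D))).
  by rewrite ler_wpM2l // mulr_ge0.
rewrite ler_peMr //; apply: mulr_ge0; [exact: mulr_ge0 | exact/ltW/ch_gt0].
Qed.
End Hyperbolic.

(** The solution is w = sqrt(1 + q/4) + sqrt(q/4), the exponential of the
    inverse hyperbolic sine of sqrt(q/4). *)
Lemma hyperbolic_parameter (R : realType) (q : R) : 0 < q ->
  exists2 w : R, 1 < w & q = 4 * sh w 1 ^+ 2.
Proof.
move=> q_gt0; set s := Num.sqrt (q / 4); set c := Num.sqrt (1 + q / 4).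
have s_gt0 : 0 < s by rewrite sqrtr_gt0 divr_gt0.
have s2 : s ^+ 2 = q / 4 by rewrite sqr_sqrtr // divr_ge0 // ltW.
have c2 : c ^+ 2 = 1 + q / 4 by rewrite sqr_sqrtr // addr_ge0 // divr_ge0 // ltW.
have c_gt1 : 1 < c.
  by rewrite -(@ltr_pXn2r _ 2) ?nnegrE ?sqrtr_ge0 // c2 expr1n ltrDl divr_gt0.
have cs_gt1 : 1 < c + s by lra.
exists (c + s) => //.
have inv_cs : (c + s) ^ (- 1) = c - s.
  have cs0 : c + s != 0 by rewrite gt_eqF // (lt_trans ltr01).
  apply: (mulfI cs0); rewrite -invr_expz expr1z divff //.
  by rewrite mulrC -subr_sqr c2 s2; ring.
rewrite [sh _ _]/sh expr1z inv_cs (_ : (_ / 2) = s) ?s2; last by field.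
by field.
Qed.

(** * Tails of the simple random walk *)

Section RandomWalk.
Variable R : realType.
Implicit Types (m : nat) (A B : pred int) (k b : int).
Local Notation P m A := (srw_prob R m A).

Lemma srw_probE m A :
  P m A = (\sum_(w : {ffun 'I_m -> bool}) (A (srw_pos w))%:R) / 2 ^+ m.
Proof.
rewrite /srw_prob -sum1_card natr_sum big_mkcond /=; congr (_ / _).
by apply: eq_bigr => w _; rewrite inE; case: (A _).
Qed.

Lemma eq_srw_prob m A B : A =1 B -> P m A = P m B.
Proof.
move=> AB; rewrite !srw_probE; congr (_ / _).
by apply: eq_bigr => w _; rewrite AB.
Qed.

Lemma le_srw_prob m A B : (forall s, A s -> B s) -> P m A <= P m B.
Proof.
move=> AB; rewrite !srw_probE ler_pM2r ?invr_gt0 ?exprn_gt0 //.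
by apply: ler_sum => w _; rewrite ler_nat; have := AB (srw_pos w); case: (A _) => // ->.
Qed.

Lemma srw_prob_ge0 m A : 0 <= P m A.
Proof. by rewrite /srw_prob divr_ge0 // exprn_ge0. Qed.

Lemma srw_probU m A B : (forall s, ~~ (A s && B s)) ->
  P m (fun s => A s || B s) = P m A + P m B.
Proof.
move=> AB; rewrite !srw_probE -mulrDl -big_split /=; congr (_ / _).
by apply: eq_bigr => w _; have := AB (srw_pos w); case: (A _); case: (B _);
  rewrite ?addr0 ?add0r.
Qed.

Lemma srw_probT m : P m xpredT = 1.
Proof.
rewrite srw_probE sumr_const card_ffun card_bool card_ord natrX.
by rewrite divff // expf_neq0 // pnatr_eq0.
Qed.

Lemma srw_prob0 A : P 0 A = (A 0)%:R.
Proof.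
rewrite srw_probE expr0 divr1 (big_pred1 [ffun=> true]) ?/srw_pos ?big_ord0 //.
by move=> w; apply/esym/eqP/ffunP=> -[].
Qed.

Lemma srw_probS m A :
  P m.+1 A = (P m (fun s => A (1 + s)) + P m (fun s => A (-1 + s))) / 2.
Proof.
rewrite !srw_probE -mulrDl exprSr invfM mulrA; congr (_ / _ / _).
pose cons_ffun (p : bool * {ffun 'I_m -> bool}) : {ffun 'I_m.+1 -> bool} :=
  [ffun k => oapp p.2 p.1 (unlift ord0 k)].
rewrite (reindex cons_ffun) /=; last first.
  exists (fun w => (w ord0, [ffun k => w (lift ord0 k)])) => [[e w] _|w _].
    by rewrite /cons_ffun ffunE unlift_none; congr (_, _); apply/ffunP=> k; rewrite !ffunE liftK.
  by apply/ffunP=> k; rewrite ffunE /=; case: unliftP => [l|] -> //=; rewrite ffunE.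
rewrite -(pair_big xpredT xpredT (fun e w => (A (srw_pos (cons_ffun (e, w))))%:R)) /=.
rewrite big_bool /=; congr (_ + _); apply: eq_bigr => w _; congr (A _)%:R.
  rewrite /srw_pos big_ord_recl ffunE unlift_none; congr (_ + _).
  by apply: eq_bigr => l _; rewrite ffunE liftK.
rewrite /srw_pos big_ord_recl ffunE unlift_none; congr (_ + _).
by apply: eq_bigr => l _; rewrite ffunE liftK.
Qed.

Lemma srw_probN m A : P m (fun s => A (- s)) = P m A.
Proof.
elim: m A => [|m IHm] A; first by rewrite !srw_prob0 oppr0.
rewrite !srw_probS -(IHm (fun s => A (1 + s))) -(IHm (fun s => A (-1 + s))) addrC.
by congr ((_ + _) / _); apply: eq_srw_prob => s; rewrite opprD ?opprK.
Qed.

(** By the reflection principle this is the probability that the walk started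
    at [k <= b] visits [b] during its first m steps. *)
Definition crossing m k b : R := P m (fun s => b <= k + s) + P m (fun s => b < k + s).

Lemma crossingS m k b :
  crossing m.+1 k b = (crossing m (k + 1) b + crossing m (k - 1) b) / 2.
Proof.
rewrite /crossing !srw_probS -mulrDl; congr (_ / _); rewrite addrACA.
by congr (_ + _ + (_ + _)); apply: eq_srw_prob => s; rewrite addrA.
Qed.

Lemma crossing_ge0 m k b : 0 <= crossing m k b.
Proof. by rewrite addr_ge0 // srw_prob_ge0. Qed.

(** By symmetry of S_m the events 0 <= S_m and S_m <= 0 are equally likely, and
    the second is complementary to 0 < S_m. *)
Lemma crossing_refl m b : crossing m b b = 1.
Proof.
rewrite /crossing -srw_probN -srw_probU => [|s]; last by lia.
by rewrite -(srw_probT m); apply: eq_srw_prob => s; lia.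
Qed.

Lemma crossing0 k b : k < b -> crossing 0 k b = 0.
Proof.
by move=> kb; rewrite /crossing !srw_prob0 addr0 leNgt kb ltNge ltW //= addr0.
Qed.

Lemma crossing_start0 m k b : crossing m k (k + b) = crossing m 0 b.
Proof.
by congr (_ + _); apply: eq_srw_prob => s; rewrite add0r ?lerD2l ?ltrD2l.
Qed.

Lemma abs_tail m (d : nat) :
  P m (fun s => d%:Z < `|s|) = 2 * P m (fun s => d%:Z < s).
Proof.
rewrite mulr2n mulrDl mul1r -[X in _ + X]srw_probN -srw_probU => [|s]; last by lia.
by apply: eq_srw_prob => s; lia.
Qed.

Lemma abs_tail_crossing m (d : nat) : P m (fun s => d%:Z < `|s|) <= crossing m 0 d.
Proof.
rewrite abs_tail mulr2n mulrDl mul1r /crossing lerD //.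
  by apply: le_srw_prob => s; lia.
by apply: le_srw_prob => s; lia.
Qed.

(** The union bound over the two barriers: the walk started at [k] avoids both r
    and -r during m steps with at least this probability. *)
Definition staying (r : nat) m k : R := 1 - crossing m k r - crossing m (- k) r.

Lemma abs_staying (r : nat) m : (0 < r)%N ->
  2 * P m (fun s => `|s| < r%:Z) - 1 <= staying r m 0.
Proof.
move=> r_gt0; rewrite /staying oppr0 /crossing.
have E : P m (fun s => `|s| < r%:Z) + 2 * P m (fun s => r%:Z <= s) = 1.
  rewrite mulr2n mulrDl mul1r -[X in _ + (X + _)]srw_probN -srw_probU => [|s]; last by lia.
  rewrite -srw_probU => [|s]; last by lia.
  by rewrite -(srw_probT m); apply: eq_srw_prob => s; lia.
have le1 : P m (fun s => r%:Z < 0 + s) <= P m (fun s => r%:Z <= s).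
  by apply: le_srw_prob => s; lia.
have -> : P m (fun s => r%:Z <= 0 + s) = P m (fun s => r%:Z <= s).
  by apply: eq_srw_prob => s; rewrite add0r.
by lra.
Qed.
(** Here [c] is the survival probability per step and [f] is harmonic for the
    killed walk. *)
Section Harmonic.
Variables (c : R) (f : int -> R).
Hypotheses (c_ge0 : 0 <= c) (c_le1 : c <= 1) (f_ge0 : forall k, 0 <= f k).
Hypothesis f_harmonic : forall k, c * (f (k + 1) + f (k - 1)) = 2 * f k.

(** Optional stopping for the harmonic function at the first visit to [b], as an
    induction on m: on the barrier [crossing] is 1, and below it both sides are
    averaged over the first step. *)
Lemma crossing_le m k b : k <= b -> c ^+ m * crossing m k b * f b <= f k.
Proof.
elim: m k => [|m IHm] k; rewrite le_eqVlt => /orP[/eqP->|kb].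
- by rewrite crossing_refl expr0 !mul1r.
- by rewrite crossing0 // mulr0 mul0r.
- by rewrite crossing_refl mulr1 ler_piMl // exprn_ile1.
have IHl : c ^+ m * crossing m (k - 1) b * f b <= f (k - 1) by apply: IHm; lia.
have IHr : c ^+ m * crossing m (k + 1) b * f b <= f (k + 1) by apply: IHm; lia.
have := ler_wpM2l c_ge0 (lerD IHr IHl); rewrite f_harmonic crossingS exprS.
by lra.
Qed.

Variable r : nat.
Hypothesis f_even : f (- r%:Z) = f r.
Hypothesis f_max : forall k, `|k| <= r%:Z -> f k <= f r.
Hypothesis fr_gt0 : 0 < f r.

(** The right-hand side is the probability that the walk from [k] is killed
    before it visits r or -r.  In the induction on m, [staying] is at most 0 on
    the boundary; inside, being killed at the first step costs 1 - c and
    [staying] is at most 1. *)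
Lemma staying_le m k : `|k| <= r%:Z ->
  (1 - c ^+ m) * staying r m k <= 1 - f k / f r.
Proof.
elim: m k => [|m IHm] k kr.
  by rewrite expr0 subrr mul0r subr_ge0 ler_pdivrMr // mul1r f_max.
have c'_ge0 : 0 <= 1 - c ^+ m.+1 by rewrite subr_ge0 exprn_ile1.
have [kE|k_neq] := eqVneq `|k| r%:Z.
  have -> : f k = f r.
    by have /orP[/eqP->|/eqP->] : (k == r%:Z) || (k == - r%:Z) by lia.
  rewrite divff ?gt_eqF // subrr mulr_ge0_le0 // /staying.
  have /orP[/eqP->|/eqP->] : (k == r%:Z) || (- k == r%:Z) by lia.
    by rewrite crossing_refl subrr sub0r oppr_le0 crossing_ge0.
  by rewrite crossing_refl addrAC subrr sub0r oppr_le0 crossing_ge0.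
have stay_step : staying r m.+1 k = (staying r m (k + 1) + staying r m (k - 1)) / 2.
  rewrite /staying !crossingS.
  by rewrite (opprD k 1) (opprB k 1) [1 - k]addrC; field.
have stay_le1 k' : staying r m k' <= 1.
  by rewrite /staying -addrA gerDl -opprD oppr_le0 addr_ge0 ?crossing_ge0.
have IHl : (1 - c ^+ m) * staying r m (k - 1) <= 1 - f (k - 1) / f r by apply: IHm; lia.
have IHr : (1 - c ^+ m) * staying r m (k + 1) <= 1 - f (k + 1) / f r by apply: IHm; lia.
have Hl : (1 - c) * staying r m (k - 1) <= 1 - c by rewrite ler_piMr // subr_ge0.
have Hr : (1 - c) * staying r m (k + 1) <= 1 - c by rewrite ler_piMr // subr_ge0.
have := ler_wpM2l c_ge0 (lerD IHr IHl).
have -> : c * (1 - f (k + 1) / f r + (1 - f (k - 1) / f r)) = 2 * c - 2 * (f k / f r).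
  by rewrite mulrA -f_harmonic; ring.
by rewrite stay_step exprS; lra.
Qed.

End Harmonic.
End RandomWalk.

(** * The two bounds *)

Section Bounds.
Variables (R : realType) (w : R).
Hypothesis w_gt1 : 1 < w.

Let survival : R := (ch w 2)^-1.

Let survival_ge0 : 0 <= survival.
Proof. by rewrite invr_ge0 ltW // ch_gt0. Qed.

Let survival_le1 : survival <= 1.
Proof. by rewrite invf_le1 ?ch_gt0 ?ch_ge1. Qed.

Let ch_survival k : survival * (ch w (k + 2) + ch w (k - 2)) = 2 * ch w k.
Proof. by rewrite ch_harmonic // /survival; field; rewrite gt_eqF // ch_gt0. Qed.

Lemma separation_upper m i d l :
  1 - same_ratio w i d l <= 1 - srw_prob R m (fun s => d%:Z < `|s|) * survival ^+ m.
Proof.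
rewrite lerD2l lerN2; apply: le_trans (same_ratio_ge w_gt1 i d l).
rewrite ler_pdivlMr ?ch_gt0 //; pose f k := ch w (2 * k + 1).
have f_harm k : survival * (f (k + 1) + f (k - 1)) = 2 * f k.
  by rewrite -ch_survival /f; congr (_ * (ch w _ + ch w _)); ring.
have := @crossing_le _ _ f survival_ge0 survival_le1 (fun k => ltW (ch_gt0 w_gt1 _)) f_harm
  m i (i%:Z + d%:Z).
rewrite lerDl crossing_start0 => /(_ isT); apply: le_trans.
rewrite (_ : (2 * (i + d) + 1)%N = 2 * (i%:Z + d%:Z) + 1 :> int); last by lia.
rewrite ler_pM2r ?ch_gt0 // mulrC ler_wpM2l ?exprn_ge0 //.
exact: abs_tail_crossing.
Qed.

Lemma separation_lower m i d l : (0 < d)%N ->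
  1 / 2 <= srw_prob R m (fun s => `|s|%:~R < d%:R / 2 :> R) ->
  (1 - survival ^+ m) ^+ 2
    * (2 * srw_prob R m (fun s => `|s|%:~R < d%:R / 2 :> R) - 1) ^+ 2
  <= 1 - same_ratio w i d l.
Proof.
move=> d_gt0; set r := uphalf d.
(* For an integer |s| < d/2 means |s| < r, also when d is odd. *)
have -> : srw_prob R m (fun s => `|s|%:~R < d%:R / 2 :> R)
        = srw_prob R m (fun s => `|s| < r%:Z).
  apply: eq_srw_prob => s; rewrite ltr_pdivlMr // -[_ * 2]/(`|s|%:~R * 2%:~R).
  by rewrite -intrM -[d%:R]/(d%:Z%:~R) ltr_int /r uphalf_half; lia.
move=> half_le; pose f k := ch w (2 * k).
have f_harm k : survival * (f (k + 1) + f (k - 1)) = 2 * f k.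
  by rewrite -ch_survival /f; congr (_ * (ch w _ + ch w _)); ring.
have f_even k : f (- k) = f k by rewrite /f mulrN chN.
have f_max k : `|k| <= r%:Z -> f k <= f r.
  move=> kr; have -> : f k = f `|k|%N by case: (intP k) => // k'; rewrite f_even.
  by apply: (@ch_homo _ _ w_gt1 (2 * `|k|) (2 * r)); lia.
have r_gt0 : (0 < r)%N by rewrite /r uphalf_half; lia.
have := @staying_le _ _ f survival_ge0 survival_le1 f_harm r (f_even r) f_max
  (ch_gt0 w_gt1 _) m 0 _; rewrite normr0 => /(_ isT).
rewrite {1}/f mulr0 ch0 // => stay.
have c'_ge0 : 0 <= 1 - survival ^+ m by rewrite subr_ge0 exprn_ile1.
have stay_abs := abs_staying R m r_gt0.
have rd : (2 * r <= d.+1)%N by rewrite /r uphalf_half; lia.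
rewrite -exprMn lerBrDl -lerBrDr; apply: le_trans (same_ratio_le w_gt1 i l d_gt0 rd) _.
rewrite lerD2l lerN2 lerXn2r ?nnegrE //.
- by rewrite mulr_ge0 //; move: half_le; lra.
- by rewrite subr_ge0 invf_le1 ?ch_gt0 ?ch_ge1.
by rewrite -[_^-1]mul1r; apply: le_trans stay; rewrite ler_wpM2l.
Qed.
End Bounds.

Theorem theorem5 (R : realType) (n : nat) (i j : 'I_n) (q : R) :
  let x := i.+1 in
  let y := j.+1 in
  let d := (y - x)%N in
  let Z := fun k : nat => path_Z k q in
  let U := separation_prob (@path_graph n) q i j in
  let P := fun (m : nat) (A : pred int) => srw_prob R m A in
  (x < y)%N -> 0 < q ->
  [/\ U = 1 - Z (n - d)%N / Z n
          - d%:R * (Z x - Z (x - 1)%N) * (Z (n - y + 1)%N - Z (n - y)%N)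
            / (q * Z n),
      (forall m : nat, (0 < m)%N ->
         1 / 2 <= P m (fun s => `|s|%:~R < d%:R / 2 :> R) ->
         (1 - (2 / (2 + q)) ^+ m) ^+ 2
           * (2 * P m (fun s => `|s|%:~R < d%:R / 2 :> R) - 1) ^+ 2 <= U)
    & (forall m : nat, (0 < m)%N ->
         U <= 1 - P m (fun s => d%:Z < `|s|) * (2 / (2 + q)) ^+ m)].
Proof.
move=> x y d Z U P xy q_gt0; pose l := (n - y)%N.
have jn := ltn_ord j.
have d_gt0 : (0 < d)%N by rewrite /d; lia.
have nE : n = (i + d + l).+1 by rewrite /d /l /x /y; move: xy; rewrite /x /y; lia.
have jE : j = (i + d)%N :> nat by rewrite /d /x /y; move: xy; rewrite /x /y; lia.
have UE : U = _ := separation_prob_path q_gt0 erefl jE nE d_gt0.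
have Zn_gt0 : 0 < open_sum q n by apply: open_sum_gt0; lia.
have UE' w : 1 < w -> q = 4 * sh w 1 ^+ 2 -> U = 1 - same_ratio w i d l.
  by move=> w_gt1 qE; rewrite -same_ratioE // -qE -nE.
split.
- rewrite UE /Z !path_Z_open_sum /x subn1 /= addn1 -/l !open_sumS.
  have -> : (n - d = (i + l).+1)%N by lia.
  by rewrite open_sumS; field; rewrite !gt_eqF.
all: have [w w_gt1 qE] := hyperbolic_parameter q_gt0.
all: have -> : 2 / (2 + q) = (ch w 2)^-1 by
  rewrite qE ch2E //; field; rewrite gt_eqF //; have := exprn_gt0 2 (sh1_gt0 w_gt1); lra.
all: rewrite (UE' w) // => m _.
  exact: separation_lower.
exact: separation_upper.
Qed.
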